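(* Let $\mathcal{X}$ be a real Banach space with $\dim\mathcal{X}\ge2$, let $p>1$, $\mathcal{F}(x)=\frac1p\|x\|^p$, and let $j_p$ be a selection of the duality mapping $J_p$ of $\mathcal{X}$. Then there exist constants $C_1,C_2>0$ such that for all $x,y\in\mathcal{X}$, not both zero, $$\Delta_{\mathcal{F}}^{j_p(x)}(y,x)\le C_1\max\{\|x\|,\|y\|\}^p\,\rho_{\mathcal{X}}\!\left(\frac{2\|x-y\|}{\max\{\|x\|,\|y\|\}}\right)$$ and $$\Delta_{\mathcal{F}}^{j_p(x)}(y,x)\ge C_2\max\{\|x\|,\|y\|\}^p\,\delta_{\mathcal{X}}\!\left(\frac{\|x-y\|}{3\max\{\|x\|,\|y\|\}}\right).$$ If $\mathcal{X}$ is $s$-smooth, then: in case $p=s$ there exists $C>0$ such that $\Delta_{\mathcal{F}}^{j_p(x)}(y,x)\le C\|x-y\|^s$ for all $x,y\in\mathcal{X}$; in case $p\ne s$, for every $\bar\tau>0$ there exists $C_{\bar\tau}>0$ such that $\Delta_{\mathcal{F}}^{j_p(x)}(y,x)\le C_{\bar\tau}\|x\|^{p-s}\|x-y\|^s$ for all $x,y\in\mathcal{X}$ with $x\neq0$ and $\frac{\|x-y\|}{\|x\|}\le\bar\tau$. If $\mathcal{X}$ is $r$-convex, then: in case $p=r$ there exists $\tilde C>0$ such that $\Delta_{\mathcal{F}}^{j_p(x)}(y,x)\ge\tilde C\|x-y\|^r$ for all $x,y\in\mathcal{X}$; in case $p\ne r$, for every $\bar\tau>0$ there exists $\tilde C_{\bar\tau}>0$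 such that $\Delta_{\mathcal{F}}^{j_p(x)}(y,x)\ge\tilde C_{\bar\tau}\|x\|^{p-r}\|x-y\|^r$ for all $x,y\in\mathcal{X}$ with $x\ne0$ and $\frac{\|x-y\|}{\|x\|}\le\bar\tau$.
   Context: $S_{\mathcal{X}}=\{x\in\mathcal{X}:\|x\|=1\}$. Duality mapping: $J_p(x)=\{x^*\in\mathcal{X}^*:\langle x^*,x\rangle=\|x^*\|\|x\|,\ \|x^*\|=\|x\|^{p-1}\}$; a selection $j_p:\mathcal{X}\to\mathcal{X}^*$ satisfies $j_p(x)\in J_p(x)$ for all $x$. Bregman divergence: $\Delta_{\mathcal{F}}^{\xi}(y,x)=\mathcal{F}(y)-\mathcal{F}(x)-\langle\xi,y-x\rangle$. Moduli: $\delta_{\mathcal{X}}:[0,2]\to[0,1]$, $\delta_{\mathcal{X}}(\varepsilon)=\inf\{1-\|y+\tilde y\|/2: y,\tilde y\in S_{\mathcal{X}},\|y-\tilde y\|=\varepsilon\}$, and $\rho_{\mathcal{X}}:[0,\infty)\to[0,\infty)$, $\rho_{\mathcal{X}}(\tau)=\sup\{(\|x+\tau y\|+\|x-\tau y\|)/2-1:x,y\in S_{\mathcal{X}}\}$. $\mathcal{X}$ is $r$-convex if there is $K>0$ with $\delta_{\mathcal{X}}(\varepsilon)\ge K\varepsilon^r$ for all $\varepsilon\in[0,2]$; it is $s$-smooth if there is $K>0$ with $\rho_{\mathcal{X}}(\tau)\le K\tau^s$ for all $\tau>0$. *)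

(* Defs.v *)
From HB Require Import structures.
From mathcomp Require Import all_boot all_order all_algebra.
From mathcomp Require Import all_classical all_reals all_analysis.
Import Order.TTheory GRing.Theory Num.Theory.
Import numFieldNormedType.Exports.

Set Implicit Arguments.
Unset Strict Implicit.
Unset Printing Implicit Defensive.

Local Open Scope classical_set_scope.
Local Open Scope ring_scope.

(* Linear independence of a pair, so that infinite-dimensional spaces are
   covered. *)
Definition dim_ge2 (R : realType) (X : lmodType R) : Prop :=
  exists u v : X, forall a b : R, a *: u + b *: v = 0 -> a = 0 /\ b = 0.

Record dual (R : realType) (X : normedModType R) := Dual {
  dual_fun :> {linear X -> R^o} ;
  dual_continuous : continuous dual_fun }.

(* The supremum is taken over a nonempty set, bounded above because f is
   continuous. *)
Definition dual_norm (R : realType) (X : normedModType R) (f : dual X) : R :=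
  sup [set `|f x| | x in [set x : X | `|x| <= 1]].

Definition duality_map (R : realType) (X : normedModType R) (p : R) (x : X) :
    set (dual X) :=
  [set f : dual X | f x = dual_norm f * `|x| /\ dual_norm f = `|x| `^ (p - 1)].

Definition duality_selection (R : realType) (X : normedModType R) (p : R)
    (j : X -> dual X) : Prop :=
  forall x, duality_map p x (j x).

Definition power_norm (R : realType) (X : normedModType R) (p : R) (x : X) : R :=
  p^-1 * `|x| `^ p.

Definition bregman (R : realType) (X : normedModType R) (F : X -> R)
    (xi : dual X) (y x : X) : R :=
  F y - F x - xi (y - x).

Definition unit_sphere (R : realType) (X : normedModType R) : set X :=
  [set x | `|x| = 1].

(* Meaningful for 0 <= eps <= 2 and dim X >= 2, where the set is nonempty;
   otherwise inf of the empty set is 0. *)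
Definition convexity_modulus (R : realType) (X : normedModType R) (eps : R) : R :=
  inf [set d | exists y y' : X,
    [/\ unit_sphere y, unit_sphere y', `|y - y'| = eps &
        d = 1 - `|y + y'| / 2]].

Definition smoothness_modulus (R : realType) (X : normedModType R) (tau : R) : R :=
  sup [set d | exists x y : X,
    [/\ unit_sphere x, unit_sphere y &
        d = (`|x + tau *: y| + `|x - tau *: y|) / 2 - 1]].

Definition r_convex (R : realType) (X : normedModType R) (r : R) : Prop :=
  exists2 K : R, 0 < K &
    forall eps : R, 0 <= eps <= 2 -> K * eps `^ r <= convexity_modulus X eps.

Definition s_smooth (R : realType) (X : normedModType R) (s : R) : Prop :=
  exists2 K : R, 0 < K &
    forall tau : R, 0 < tau -> smoothness_modulus X tau <= K * tau `^ s.

(* Main.v *)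
(* Write a = |x|, b = |y|, and let g be a norm-one functional with g x = a, so
   that j_p(x) = a^(p-1) g. The divergence is the Young gap
   b^p/p - a^p/p - a^(p-1) (b - a), which is comparable to (a - b)^2 after
   scaling to max (a, b) = 1, plus the angular term a^(p-1) (b - g y). The
   angular term is bounded below by the modulus of convexity of the normalized
   vectors, and above by |x + h| + |x - h| - 2a with h = y - x, hence by the
   modulus of smoothness. The quadratic term is absorbed because in dimension at
   least 2 the moduli satisfy delta(t) <= K t^2 and rho(t) >= k t^2 with
   constants depending on X: on a two-dimensional subspace, take a Euclidean
   norm and rescale it so that it touches the given norm at a maximum
   (resp. minimum) of the ratio of the two norms. *)

Require Import Defs.
From HB Require Import structures.
From mathcomp Require Import all_boot all_order all_algebra.
From mathcomp Require Import all_classical all_reals all_analysis.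
From mathcomp Require Import ring lra.
Import Order.TTheory GRing.Theory Num.Theory.
Import numFieldNormedType.Exports.

Set Implicit Arguments.
Unset Strict Implicit.
Unset Printing Implicit Defensive.

Local Open Scope ring_scope.

(** * Scalar estimates for powers and the Young gap *)

Definition young_gap {R : realType} (p a b : R) : R :=
  (b `^ p - a `^ p) / p - a `^ (p - 1) * (b - a).

(** Young's inequality for the product [t * 1] with exponents [p] and [p / (p - 1)], multiplied by
    [p]. *)
Lemma powR_ge_tangent1 (R : realType) (p t : R) :
  1 < p -> 0 <= t -> 1 + p * (t - 1) <= t `^ p.
Proof.
move=> p1 t0.
have p0 : 0 < p by lra.
have pN : p != 0 by rewrite gt_eqF.
have qN : p - 1 != 0 by rewrite gt_eqF//; lra.
have q0 : 0 < p / (p - 1) by rewrite divr_gt0//; lra.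
have := @conjugate_powR R t 1 p (p / (p - 1)) t0 ler01 p0 q0.
rewrite powR1 => /(_ _)/wrap[|h]; first by field; rewrite pN qN.
rewrite mulr1 in h.
have : p * t <= p * (t `^ p / p + 1 / (p / (p - 1))) by rewrite ler_pM2l.
have -> : p * (t `^ p / p + 1 / (p / (p - 1))) = t `^ p + (p - 1).
  by field; rewrite pN qN.
lra.
Qed.

Lemma one_sub_powR_ge (R : realType) (k t : R) : 0 < k -> 0 <= t <= 1 ->
  Num.min 1 k * (1 - t) <= 1 - t `^ k.
Proof.
move=> k0 /andP[t0 t1]; have t1' : 0 <= 1 - t by lra.
have [->|tN] := eqVneq t 0.
  by rewrite powR0 ?gt_eqF// !subr0 mulr1 ge_min lexx.
have tp : 0 < t by rewrite lt_neqAle eq_sym tN.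
have [k1|k1] := leP 1 k.
  rewrite mul1r lerB//.
  by have := @ge1r_powR R t k; rewrite tp t1; apply.
suff : t `^ k <= 1 + k * (t - 1) by lra.
have [ke|kn] := eqVneq k 1; first by lra.
(* For [k < 1] the concavity bound on [t]^ k[is the tangent inequality for the inverse power, taken
   at the point]t [^ k]. *)
have := @powR_ge_tangent1 R k^-1 (t `^ k).
rewrite -powRrM divff ?gt_eqF// powRr1// => /(_ _ _)/wrap[||h].
- by rewrite invf_gt1.
- exact: powR_ge0.
have : k * (1 + k^-1 * (t `^ k - 1)) <= k * t by rewrite ler_pM2l.
have -> : k * (1 + k^-1 * (t `^ k - 1)) = k + t `^ k - 1.
  by field; rewrite gt_eqF.
lra.
Qed.

Lemma one_sub_powR_le (R : realType) (k t : R) : 0 < k -> 0 <= t <= 1 ->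
  1 - t `^ k <= Num.max 1 k * (1 - t).
Proof.
move=> k0 /andP[t0 t1]; have t1' : 0 <= 1 - t by lra.
have [k1|k1] := leP 1 k.
  have [ke|kn] := eqVneq k 1; first by rewrite ke powRr1//; lra.
  have := @powR_ge_tangent1 R k t; rewrite lt_neqAle eq_sym kn k1.
  by move=> /(_ isT t0); lra.
rewrite mul1r lerB//.
have [->|tN] := eqVneq t 0; first exact: powR_ge0.
have tp : 0 < t by rewrite lt_neqAle eq_sym tN.
by have := @ger1_powR R t k; rewrite tp t1 (ltW k1); apply.
Qed.

Lemma powR_sub_factor (R : realType) (k l u : R) : 0 <= l -> 0 < u ->
  u `^ k - l `^ k = u `^ k * (1 - (l / u) `^ k).
Proof.
move=> l0 u0; have u0' := ltW u0; rewrite mulrBr mulr1 -powRM ?divr_ge0//.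
by rewrite mulrCA divff ?gt_eqF// mulr1.
Qed.

(* Since [u <= 1], the derivative factor [u `^ (k - 1)] is at least
   [u `^ k >= 2^-1 `^ k], whatever the sign of [k - 1]. *)
Lemma powR_sub_ge (R : realType) (k l u : R) : 0 < k ->
  0 <= l <= u -> 2^-1 <= u <= 1 ->
  2^-1 `^ k * Num.min 1 k * (u - l) <= u `^ k - l `^ k.
Proof.
move=> k0 /andP[l0 lu] /andP[u2 u1].
have u0 : 0 < u by lra.
rewrite powR_sub_factor//.
have m0 : 0 <= Num.min 1 k by rewrite le_min ler01 ltW.
have lu1 : 0 <= l / u <= 1 by rewrite (divr_ge0 l0 (ltW u0))/= ler_pdivrMr ?mul1r.
have e : u - l = u * (1 - l / u) by field; rewrite gt_eqF.
have f0 : 0 <= 1 - l / u by lra.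
rewrite -mulrA ler_pM ?powR_ge0 ?mulr_ge0 ?subr_ge0//.
- by apply: ge0_ler_powR; rewrite ?nnegrE ?invr_ge0//; lra.
- apply: le_trans (@one_sub_powR_ge R k (l / u) k0 lu1).
  by rewrite ler_wpM2l// e ler_piMl.
Qed.

Lemma powR_sub_le (R : realType) (k l u : R) : 0 < k ->
  0 <= l <= u -> 2^-1 <= u <= 1 ->
  u `^ k - l `^ k <= 2 * Num.max 1 k * (u - l).
Proof.
move=> k0 /andP[l0 lu] /andP[u2 u1].
have u0 : 0 < u by lra.
rewrite powR_sub_factor//.
have lu1 : 0 <= l / u <= 1 by rewrite (divr_ge0 l0 (ltW u0))/= ler_pdivrMr ?mul1r.
have f0 : 0 <= 1 - l / u by lra.
have e : 1 - l / u <= 2 * (u - l).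
  have -> : 1 - l / u = u^-1 * (u - l) by field; rewrite gt_eqF.
  rewrite ler_wpM2r//; first lra.
  by rewrite -[leRHS]invrK lef_pV2 ?posrE ?invr_gt0.
have m1 : 1 <= Num.max 1 k by rewrite le_max lexx.
have uk : u `^ k <= 1.
  have -> : 1 = 1 `^ k :> R by rewrite powR1.
  by apply: ge0_ler_powR; rewrite ?nnegrE//; lra.
have lk : 0 <= 1 - (l / u) `^ k.
  apply: le_trans (@one_sub_powR_ge R k (l / u) k0 lu1).
  by rewrite mulr_ge0// le_min ler01 ltW.
apply: (@le_trans _ _ (1 - (l / u) `^ k)); first by rewrite ler_piMl.
apply: le_trans (@one_sub_powR_le R k (l / u) k0 lu1) _.
by rewrite (mulrC 2) -mulrA ler_wpM2l//; lra.
Qed.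

Lemma young_gap_ge0 (R : realType) (p a b : R) :
  1 < p -> 0 <= a -> 0 <= b -> 0 <= young_gap p a b.
Proof.
move=> p1 a0 b0; rewrite /young_gap.
have p0 : 0 < p by lra.
have pN : p != 0 by rewrite gt_eqF.
have [->|aN] := eqVneq a 0.
  rewrite !powR0 ?gt_eqF//; last lra.
  by rewrite mul0r !subr0 divr_ge0 ?powR_ge0 ?ltW.
have ap : 0 < a by rewrite lt_neqAle eq_sym aN.
have t := @powR_ge_tangent1 R p (b / a) p1 (divr_ge0 b0 a0).
have ea : a * a `^ (p - 1) = a `^ p by rewrite mulr_powRB1.
have eb : b `^ p = a `^ p * (b / a) `^ p.
  by rewrite -powRM ?divr_ge0// mulrCA divff// mulr1.
have : a `^ p * (1 + p * (b / a - 1)) <= a `^ p * (b / a) `^ p.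
  by rewrite ler_wpM2l ?powR_ge0.
rewrite -eb -{1}ea.
have -> : a * a `^ (p - 1) * (1 + p * (b / a - 1)) =
  a `^ p + p * (a `^ (p - 1) * (b - a)) by rewrite -ea; field.
move=> h.
rewrite subr_ge0 ler_pdivlMr// mulrC; lra.
Qed.

Lemma young_gap_three_points (R : realType) (p a b m : R) :
  young_gap p a b = young_gap p a m + young_gap p m b +
    (m `^ (p - 1) - a `^ (p - 1)) * (b - m).
Proof. by rewrite /young_gap; ring. Qed.

Lemma young_gap_scale (R : realType) (p M a b : R) :
  1 < p -> 0 <= M -> 0 <= a -> 0 <= b ->
  young_gap p (M * a) (M * b) = M `^ p * young_gap p a b.
Proof.
move=> p1 M0 a0 b0; rewrite /young_gap !powRM//.
have -> : M `^ p = M * M `^ (p - 1) by rewrite mulr_powRB1//; lra.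
by ring.
Qed.

(* The three-point identity at the midpoint [m] reduces the quadratic bound to
   a first-order bound on [m `^ (p - 1) - a `^ (p - 1)]; the maximum of [m] and
   [a] is at least 1/2. *)
Lemma young_gap_ge (R : realType) (p : R) : 1 < p ->
  exists2 c : R, 0 < c & forall a b : R, 0 <= a -> 0 <= b ->
    Num.max a b = 1 -> c * (a - b) ^+ 2 <= young_gap p a b.
Proof.
move=> p1; have k0 : 0 < p - 1 by lra.
set c := 2^-1 `^ (p - 1) * Num.min 1 (p - 1).
have c0 : 0 < c by rewrite mulr_gt0 ?powR_gt0 ?lt_min ?ltr01//; lra.
exists (c / 4); first by rewrite divr_gt0.
move=> a b a0 b0 ab1.
pose m := (a + b) / 2.
have m0 : 0 <= m by rewrite /m; lra.
rewrite (young_gap_three_points p a b m).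
have := young_gap_ge0 p1 a0 m0; have := young_gap_ge0 p1 m0 b0.
move=> h1 h2; apply: (@le_trans _ _ ((m `^ (p - 1) - a `^ (p - 1)) * (b - m)));
  last by lra.
have [ab|ba] := leP a b.
  have bE : b = 1 by move: ab1; rewrite max_r.
  have := @powR_sub_ge R (p - 1) a m k0 _ _; rewrite -/c.
  move=> /(_ _ _)/wrap[||h]; [rewrite /m; lra|rewrite /m; lra|].
  have : c * (m - a) * (b - m) <= (m `^ (p - 1) - a `^ (p - 1)) * (b - m).
    by rewrite ler_wpM2r// /m; lra.
  by apply: le_trans; rewrite le_eqVlt; apply/orP; left; apply/eqP; rewrite /m; field.
have aE : a = 1 by move: ab1; rewrite max_l// ltW.
have := @powR_sub_ge R (p - 1) m a k0 _ _; rewrite -/c.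
move=> /(_ _ _)/wrap[||h]; [rewrite /m; lra|rewrite /m; lra|].
have : c * (a - m) * (m - b) <= (a `^ (p - 1) - m `^ (p - 1)) * (m - b).
  by rewrite ler_wpM2r// /m; lra.
rewrite -[leRHS]mulrNN !opprB.
by apply: le_trans; rewrite le_eqVlt; apply/orP; left; apply/eqP; rewrite /m; field.
Qed.

(** The gap from [a] to [b] and the gap from [b] to [a] add up to [(b]^ (p - 1) - a
    [^ (p - 1)) * (b - a)]. Dropping the second, which is nonnegative, leaves a first-order bound to
    apply. *)
Lemma young_gap_le (R : realType) (p : R) : 1 < p ->
  exists2 c : R, 0 < c & forall a b : R, 0 <= a -> 0 <= b ->
    Num.max a b = 1 -> young_gap p a b <= c * (a - b) ^+ 2.
Proof.
move=> p1; have k0 : 0 < p - 1 by lra.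
set c := 2 * Num.max 1 (p - 1).
have c0 : 0 < c by rewrite mulr_gt0// lt_max ltr01.
exists c => // a b a0 b0 ab1.
have : young_gap p a b <= (b `^ (p - 1) - a `^ (p - 1)) * (b - a).
  have := young_gap_ge0 p1 b0 a0.
  have := young_gap_three_points p a a b.
  have -> : young_gap p a a = 0 by rewrite /young_gap; ring.
  lra.
move/le_trans; apply.
have [ab|ba] := leP a b.
  have bE : b = 1 by move: ab1; rewrite max_r.
  have := @powR_sub_le R (p - 1) a b k0 _ _; rewrite -/c.
  move=> /(_ _ _)/wrap[||h]; [lra|lra|].
  have : (b `^ (p - 1) - a `^ (p - 1)) * (b - a) <= c * (b - a) * (b - a).
    by rewrite ler_wpM2r//; lra.
  by move/le_trans; apply; rewrite le_eqVlt; apply/orP; left; apply/eqP; ring.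
have aE : a = 1 by move: ab1; rewrite max_l// ltW.
have := @powR_sub_le R (p - 1) b a k0 _ _; rewrite -/c.
move=> /(_ _ _)/wrap[||h]; [lra|lra|].
have : (a `^ (p - 1) - b `^ (p - 1)) * (a - b) <= c * (a - b) * (a - b).
  by rewrite ler_wpM2r//; lra.
rewrite -[leLHS]mulrNN !opprB.
by move/le_trans; apply; rewrite le_eqVlt; apply/orP; left; apply/eqP; ring.
Qed.

Local Open Scope classical_set_scope.

(** * Euclidean norms on a plane touching the given norm *)

Lemma circle_compact (R : realType) :
  compact [set z : R * R | z.1 ^+ 2 + z.2 ^+ 2 = 1].
Proof.
have cq : continuous (fun z : R * R => z.1 * z.1 + z.2 * z.2).
  move=> z; apply: (@cvgD _ R^o); apply: cvgM;
    by [exact: cvg_fst | exact: cvg_snd].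
have cC : closed [set z : R * R | z.1 ^+ 2 + z.2 ^+ 2 = 1].
  have := preimage_closed (fun z _ => cq z) (@closed_eq R 1).
  by congr closed; apply/seteqP; split => z /=; rewrite !expr2.
apply: (subclosed_compact cC (compact_setX (@segment_compact R (-1) 1)
  (@segment_compact R (-1) 1))).
move=> [a b] /= h.
suff: `|a| <= 1 /\ `|b| <= 1 by rewrite !ler_norml !in_itv.
have a2 := sqr_ge0 a; have b2 := sqr_ge0 b.
by split; rewrite -(@ler_pXn2r _ 2)// ?nnegrE// expr1n real_normK ?num_real//; lra.
Qed.

Lemma norm_comb_continuous (R : realType) (X : normedModType R) (u v : X) :
  continuous (fun z : R * R => `|z.1 *: u + z.2 *: v|).
Proof.
move=> z; apply: cvg_norm; apply: cvgD; apply: cvgZr_tmp.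
- exact: cvg_fst.
- exact: cvg_snd.
Qed.

Lemma comb_neq0 (R : realType) (X : normedModType R) (u v : X) :
  (forall a b : R, a *: u + b *: v = 0 -> a = 0 /\ b = 0) ->
  forall a b : R, a ^+ 2 + b ^+ 2 = 1 -> 0 < `|a *: u + b *: v|.
Proof.
move=> uv a b ab1; rewrite normr_gt0; apply/eqP => /uv[a0 b0].
by move: ab1; rewrite a0 b0 expr0n/= addr0 => /eqP; rewrite eq_sym oner_eq0.
Qed.

Lemma polar_coordinates (R : realType) (s t : R) : exists n a b : R,
  [/\ 0 <= n, s = n * a, t = n * b & a ^+ 2 + b ^+ 2 = 1].
Proof.
have [st0|st0] := eqVneq (s ^+ 2 + t ^+ 2) 0.
  exists 0, 1, 0; rewrite !mul0r expr1n expr0n/= addr0; split => //.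
    by apply/eqP; rewrite -sqrf_eq0; move: st0 (sqr_ge0 s) (sqr_ge0 t); lra.
  by apply/eqP; rewrite -sqrf_eq0; move: st0 (sqr_ge0 s) (sqr_ge0 t); lra.
have sp : 0 < s ^+ 2 + t ^+ 2.
  by rewrite lt_neqAle eq_sym st0 addr_ge0 ?sqr_ge0.
pose n := Num.sqrt (s ^+ 2 + t ^+ 2).
have n0 : n != 0 by rewrite gt_eqF// sqrtr_gt0.
exists n, (s / n), (t / n); split; first exact: sqrtr_ge0.
- by rewrite mulrCA divff ?mulr1.
- by rewrite mulrCA divff ?mulr1.
- by rewrite !expr_div_n -mulrDl sqr_sqrtr ?ltW// divff// gt_eqF.
Qed.

(** The coefficients on the right are the real and imaginary parts of [(a + i b) (c + i d)]. *)
Lemma comb_rotate (R : realType) (X : normedModType R) (u v : X) (m c d a b : R) :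
  a *: (m^-1 *: (c *: u + d *: v)) + b *: (m^-1 *: (c *: v - d *: u)) =
  m^-1 *: ((a * c - b * d) *: u + (a * d + b * c) *: v).
Proof.
rewrite !scalerA (mulrC a) (mulrC b) -!scalerA -scalerDr; congr (_ *: _).
rewrite scalerDr scalerBr !scalerA scalerBl scalerDl.
by rewrite [X in _ + X]addrC addrACA.
Qed.

Lemma circle_rotate (R : realType) (c d a b : R) : c ^+ 2 + d ^+ 2 = 1 ->
  (a * c - b * d) ^+ 2 + (a * d + b * c) ^+ 2 = a ^+ 2 + b ^+ 2.
Proof. by move=> h; rewrite -[RHS]mulr1 -h; ring. Qed.

(** The frame is the rotation of [(u, v)] taking [u] to the direction [(c, d)], scaled so that its
    first vector has norm one. The last factor compares the norm at a point of the circle with the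
    norm at [(c, d)], so it is at most 1 if [(c, d)] maximises the norm on the circle, and at least
    1 if it minimises it. *)
Lemma rotated_frame (R : realType) (X : normedModType R) (u v : X) (c d : R) :
  (forall a b : R, a *: u + b *: v = 0 -> a = 0 /\ b = 0) ->
  c ^+ 2 + d ^+ 2 = 1 ->
  exists e e' : X, [/\ `|e| = 1, e' != 0 &
    forall a b : R, exists2 z : R * R, z.1 ^+ 2 + z.2 ^+ 2 = 1 &
      `|a *: e + b *: e'| ^+ 2 = (a ^+ 2 + b ^+ 2) *
        (`|c *: u + d *: v|^-1 * `|z.1 *: u + z.2 *: v|) ^+ 2].
Proof.
move=> uv cd1; have m0 := comb_neq0 uv cd1.
set m := `|c *: u + d *: v| in m0 *.
have mN : `|m^-1| = m^-1 by rewrite ger0_norm// invr_ge0 ltW.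
exists (m^-1 *: (c *: u + d *: v)), (m^-1 *: (c *: v - d *: u)); split.
- by rewrite normrZ mN mulVf// gt_eqF.
- rewrite -normr_gt0 normrZ mN mulr_gt0 ?invr_gt0//.
  by rewrite addrC -scaleNr comb_neq0// sqrrN addrC.
- move=> a b; rewrite comb_rotate normrZ mN.
  have := circle_rotate a b cd1.
  move: (a * c - b * d) (a * d + b * c) => s t <-.
  have [n [x [y [n0 -> -> xy1]]]] := polar_coordinates s t.
  exists (x, y) => //=.
  rewrite -!scalerA -scalerDr normrZ (ger0_norm n0) !exprMn -mulrDr xy1 mulr1.
  by rewrite mulrCA.
Qed.

(** Geometrically, a Euclidean disc lies inside the unit ball of the plane and touches it at [e]. *)
Lemma max_direction (R : realType) (X : normedModType R) : dim_ge2 X ->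
  exists e e' : X, [/\ `|e| = 1, e' != 0 &
    forall a b : R, `|a *: e + b *: e'| ^+ 2 <= a ^+ 2 + b ^+ 2].
Proof.
move=> [u [v uv]].
have [|[c d]] := compact_EVT_max _ (@circle_compact R)
  (continuous_subspaceT (@norm_comb_continuous R X u v)).
- by exists (1, 0); rewrite /= expr1n expr0n/= addr0.
rewrite inE /= => cd1 cdmax; have m0 := comb_neq0 uv cd1.
have [e [e' [e1 e'0 frame]]] := rotated_frame uv cd1.
exists e, e'; split=> // a b; have [z z1 ->] := frame a b.
have := cdmax z; rewrite inE/= => /(_ z1) h.
rewrite ler_piMr ?addr_ge0 ?sqr_ge0//.
by rewrite expr_le1 ?mulr_ge0 ?invr_ge0// ler_pdivrMl ?mulr1.
Qed.

(** Here the unit ball of the plane lies inside the Euclidean disc and touches its boundary at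
    [e]. *)
Lemma min_direction (R : realType) (X : normedModType R) : dim_ge2 X ->
  exists e e' : X, [/\ `|e| = 1, e' != 0 &
    forall a b : R, a ^+ 2 + b ^+ 2 <= `|a *: e + b *: e'| ^+ 2].
Proof.
move=> [u [v uv]].
have [|[c d]] := compact_EVT_min _ (@circle_compact R)
  (continuous_subspaceT (@norm_comb_continuous R X u v)).
- by exists (1, 0); rewrite /= expr1n expr0n/= addr0.
rewrite inE /= => cd1 cdmin; have m0 := comb_neq0 uv cd1.
have [e [e' [e1 e'0 frame]]] := rotated_frame uv cd1.
exists e, e'; split=> // a b; have [z z1 ->] := frame a b.
have := cdmin z; rewrite inE/= => /(_ z1) h.
rewrite ler_peMr ?addr_ge0 ?sqr_ge0//.
by rewrite expr_ge1 ?mulr_ge0 ?invr_ge0// ler_pdivlMl ?mulr1.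
Qed.

(** * Norming functionals *)

(** The one-sided bound, used at [z] and [- z], says that [g] has norm at most one, so boundedness
    is built in and a plain linear map can carry the notion. *)
Definition norming {R : realType} {X : normedModType R} (g : {linear X -> R^o})
  (x : X) : Prop := (forall z, g z <= `|z|) /\ g x = `|x|.

(** Continuity bounds [f] on the unit ball, so the supremum in [dual_norm] is a genuine one;
    homogeneity does the rest. *)
Lemma dual_bound (R : realType) (X : normedModType R) (f : dual X) (z : X) :
  `|f z| <= dual_norm f * `|z|.
Proof.
have fc : continuous f := @dual_continuous R X f.
have [M Mf] : exists M, forall x : X, `|f x| <= M * `|x|.
  have /linear_boundedP := @continuous_linear_bounded _ _ _ 0 f (fc 0).
  by move/filter_ex.
have ub : has_ubound [set `|f x| | x in [set x : X | `|x| <= 1]].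
  exists `|M| => _ [x /= x1 <-]; apply: le_trans (Mf x) _.
  apply: le_trans (ler_norm _) _; rewrite normrM normr_id.
  by rewrite ler_piMr.
have [->|zN] := eqVneq z 0; first by rewrite linear0 !normr0 mulr0.
have z0 : 0 < `|z| by rewrite normr_gt0.
have zi : `| `|z|^-1| = `|z|^-1 by rewrite ger0_norm// invr_ge0.
have : `|f (`|z|^-1 *: z)| <= dual_norm f.
  apply: (ub_le_sup ub); exists (`|z|^-1 *: z) => //=.
  by rewrite normrZ zi mulVf// gt_eqF.
rewrite linearZ/= normrM zi.
by rewrite ler_pdivrMl// mulrC.
Qed.

Lemma norming_functional (R : realType) (X : normedModType R) (p : R)
    (j : X -> dual X) : 1 < p -> duality_selection p j ->
  forall x, exists2 g : {linear X -> R^o}, norming g x &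
    forall z, j x z = `|x| `^ (p - 1) * g z.
Proof.
move=> p1 hj x; have [jx jn] := hj x.
have [x0|xN] := eqVneq x 0.
  (* At the origin [p > 1] forces [j 0 = 0], and the zero functional is norming there. *)
  have dn : dual_norm (j x) = 0.
    by rewrite jn x0 normr0 powR0// gt_eqF//; lra.
  exists \0 => [|z]; first by split => [z|]; rewrite /= ?x0 ?normr0.
  have := dual_bound (j x) z.
  by rewrite dn mul0r normr_le0 => /eqP ->; rewrite /= mulr0.
have a0 : 0 < `|x| `^ (p - 1) by rewrite powR_gt0// normr_gt0.
exists ((`|x| `^ (p - 1))^-1 \*: (j x : {linear X -> R^o})) => [|z /=].
  split => [z|] /=; rewrite /GRing.scale/=.
    rewrite ler_pdivrMl// -jn; apply: le_trans (ler_norm _) _.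
    exact: dual_bound.
  by rewrite jx jn mulKf// gt_eqF.
by rewrite /GRing.scale/= mulVKf// gt_eqF.
Qed.

(** * The modulus of convexity: angular bound and quadratic upper bound *)

Definition normalize {R : realType} {X : normedModType R} (z : X) : X :=
  `|z|^-1 *: z.

Lemma norm_normalize (R : realType) (X : normedModType R) (z : X) :
  z != 0 -> `|normalize z| = 1.
Proof.
move=> z0; rewrite normrZ ger0_norm ?invr_ge0//.
by rewrite mulVf// normr_eq0.
Qed.

Lemma normalize_unit (R : realType) (X : normedModType R) (z : X) :
  `|z| = 1 -> normalize z = z.
Proof. by move=> z1; rewrite /normalize z1 invr1 scale1r. Qed.

Lemma normalize_cvg (R : realType) (X : normedModType R) (w : R -> X) (s : R) :
  {for s, continuous w} -> w s != 0 ->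
  {for s, continuous (fun t => normalize (w t))}.
Proof.
move=> cw w0; apply: cvgZ => //.
by apply: cvgV; rewrite ?normr_eq0//; apply: cvg_norm.
Qed.

Lemma convexity_modulus_le (R : realType) (X : normedModType R) (y y' : X) :
  `|y| = 1 -> `|y'| = 1 -> convexity_modulus X `|y - y'| <= 1 - `|y + y'| / 2.
Proof.
move=> y1 y'1; apply: ge_inf; last by exists y, y'.
exists 0 => _ [u [v [u1 v1 _ ->]]].
by have := ler_normD u v; rewrite u1 v1; lra.
Qed.

Lemma convexity_modulus_le1 (R : realType) (X : normedModType R) (eps : R) :
  convexity_modulus X eps <= 1.
Proof.
rewrite /convexity_modulus; set D := [set d | _].
have [[d [y [y' [y1 y'1 ye _]]]]|D0] := pselect (D !=set0).
  rewrite /D -ye.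
  apply: le_trans (convexity_modulus_le y1 y'1) _.
  by rewrite lerBlDr lerDl divr_ge0.
(* Without an admissible pair the infimum takes its default value 0. *)
suff -> : D = set0 by rewrite inf0.
by apply/eqP/negPn/negP => /set0P.
Qed.

Lemma segment_cvg (R : realType) (X : normedModType R) (u v : X) (s : R) :
  {for s, continuous (fun t : R => (1 - t) *: u + t *: v)}.
Proof.
apply: cvgD; apply: cvgZr_tmp; last exact: cvg_id.
by apply: (@cvgB _ R^o); [exact: cvg_cst | exact: cvg_id].
Qed.

Lemma IVT01 (R : realType) (f : R -> R) (t : R) :
  {in `[0, 1]%R, continuous f} -> f 0 <= t <= f 1 ->
  exists2 s, 0 <= s <= 1 & f s = t.
Proof.
move=> cf /andP[t0 t1].
have [||s] := @IVT R f 0 1 t ler01.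
- apply: continuous_in_subspaceT => s; rewrite inE/= => s01.
  by apply: cf; rewrite inE.
- by rewrite ge_min t0 le_max t1 orbT.
by rewrite in_itv/= => s01 <-; exists s.
Qed.

(* The pair realising [t] is [u] and a point of the radial projection of the
   segment [u, v] on the sphere, on which [g] stays above [g v]. *)
Lemma convexity_modulus_le_norming (R : realType) (X : normedModType R)
    (g : {linear X -> R^o}) (u v : X) (t : R) :
  norming g u -> `|u| = 1 -> `|v| = 1 -> 0 <= t <= `|u - v| ->
  convexity_modulus X t <= 1 - g v.
Proof.
move=> [gle gu] u1 v1 /andP[t0 t1]; rewrite u1 in gu.
have [gv|gv] := leP (g v) 0.
  by apply: le_trans (convexity_modulus_le1 _ _) _; lra.
have gv1 : g v <= 1 by rewrite -v1.
pose z s := (1 - s) *: u + s *: v.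
have gz s : 0 <= s <= 1 -> g v <= g (z s).
  move=> s01; rewrite /z linearD !linearZ/= gu /GRing.scale/= mulr1.
  by nra.
(* Positivity of [g v] keeps the segment away from the origin, so its radial projection is defined
   and continuous. *)
have z0 s : 0 <= s <= 1 -> z s != 0.
  by move=> /gz; apply: contraTneq => ->; rewrite linear0 -ltNge.
have z1 s : 0 <= s <= 1 -> `|z s| <= 1.
  move=> /andP[s0 s1]; apply: le_trans (ler_normD _ _) _.
  rewrite !normrZ u1 v1 !mulr1 ger0_norm ?subr_ge0// ger0_norm//; lra.
have [||s s01 ts] := @IVT01 R (fun s => `|u - normalize (z s)|) t.
- move=> s; rewrite in_itv/= => s01; apply: cvg_norm; apply: cvgB.
    exact: cvg_cst.
  by apply: normalize_cvg (z0 _ s01); exact: segment_cvg.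
- have -> : z 0 = u by rewrite /z subr0 scale1r scale0r addr0.
  have -> : z 1 = v by rewrite /z subrr scale1r scale0r add0r.
  by rewrite !normalize_unit// subrr normr0 t0 t1.
rewrite -ts.
apply: le_trans (convexity_modulus_le u1 (norm_normalize (z0 s s01))) _.
(* Since [|z s| <= 1] and [g] is positive there, normalising can only raise [g]. *)
have : g v <= g (normalize (z s)).
  rewrite linearZ/= /GRing.scale/= ler_pdivlMl ?normr_gt0 ?z0//.
  apply: le_trans (gz s s01); rewrite ler_piMl ?z1// ltW//.
have := gle (u + normalize (z s)); rewrite linearD/= gu.
lra.
Qed.

(** The test pairs are the normalisations of [(1 - s) *: e + s *: e'] and of its reflection in the
    axis [e]. The functional [g] bounds the norm of their sum from below, and the inscribed disc
    makes the defect of that sum quadratic in their distance. *)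
Lemma convexity_modulus_quadratic (R : realType) (X : normedModType R) :
  dim_ge2 X ->
  (forall x : X, exists g : {linear X -> R^o}, norming g x) ->
  exists2 K : R, 0 < K & forall eps : R, 0 <= eps <= 2 ->
    convexity_modulus X eps <= K * eps ^+ 2.
Proof.
move=> /max_direction[e [e' [e1 e'0 emax]]] ex.
have [g [gle ge]] := ex e; rewrite e1 in ge.
have k0 : 0 < `|e'| by rewrite normr_gt0.
set k := `|e'| in k0.
(* [g] vanishes on [e'] because the disc lies inside the unit ball and both
   touch at [e]. *)
have ge' : g e' = 0.
  have := gle (1 *: e + g e' *: e'); have := emax 1 (g e').
  rewrite linearD !linearZ/= /GRing.scale/= ge mulr1.
  set kappa : R := g e'; set N : R := `|_| => h1 h2.
  have h3 : (1 + kappa * kappa) ^+ 2 <= N ^+ 2.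
    by rewrite ler_sqr ?nnegrE ?(le_trans _ h2) ?addr_ge0 -?expr2 ?sqr_ge0.
  have h4 : (1 + kappa * kappa) ^+ 2 <= 1 ^+ 2 + kappa ^+ 2 by lra.
  apply/eqP; rewrite -sqrf_eq0 -/kappa; have := sqr_ge0 kappa; nra.
have gc (a b : R) : g (a *: e + b *: e') = a.
  by rewrite linearD !linearZ/= /GRing.scale/= ge ge' mulr0 mulr1 addr0.
have ale (a b : R) : `|a| <= `|a *: e + b *: e'|.
  rewrite ler_norml -{1}normrN lerNl -{1}(gc (- a) (- b)).
  rewrite -{3}(gc a b) gle andbT.
  by apply: le_trans (gle _) _; rewrite !scaleNr -opprD.
(* The factor 2 comes from the triangle inequality, once [|a|] is bounded by the whole norm through
   [ale]. *)
have ble (a b : R) : `|b| * k <= 2 * `|a *: e + b *: e'|.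
  have := ler_normB (a *: e + b *: e') (a *: e).
  rewrite addrC addKr !normrZ e1 mulr1 -/k => h.
  by have := ale a b; lra.
pose w s := (1 - s) *: e + s *: e'; pose w' s := (1 - s) *: e + s *: (- e').
have w'E s : w' s = (1 - s) *: e + (- s) *: e' by rewrite /w' scalerN scaleNr.
have nz (s c : R) : `|c| = `|s| -> (1 - s) *: e + c *: e' != 0.
  move=> cs; apply/eqP => h; have := ale (1 - s) c; have := ble (1 - s) c.
  rewrite h normr0 mulr0 normr_le0 cs => h1 /eqP h2.
  have s1 : s = 1 by lra.
  by move: h1; rewrite s1 normr1 mul1r leNgt k0.
have w0 s : w s != 0 by exact: nz.
have w'0 s : w' s != 0 by rewrite w'E nz// normrN.
exists (k^-1 ^+ 2); first by rewrite exprn_gt0// invr_gt0.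
move=> eps eps2.
(* The two points coincide at [s = 0] and are antipodal at [s = 1], so their distance takes every
   value in [[0, 2]]. *)
have [||s /andP[s0 s1] es] :=
  @IVT01 R (fun s => `|normalize (w s) - normalize (w' s)|) eps.
- move=> s _; apply: cvg_norm; apply: cvgB.
    by apply: normalize_cvg (w0 s); exact: segment_cvg.
  by apply: normalize_cvg (w'0 s); exact: segment_cvg.
- rewrite /w /w' subr0 subrr !scale1r !scale0r !add0r !addr0 subrr normr0.
  have -> : normalize e' - normalize (- e') = 2 *: normalize e'.
    by rewrite /normalize normrN scalerN opprK scaler_nat mulr2n.
  by rewrite normrZ norm_normalize// ger0_norm// mulr1.
rewrite -es.
apply: le_trans (convexity_modulus_le (norm_normalize (w0 s))
  (norm_normalize (w'0 s))) _.
rewrite es.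
set A := `|w s|; set B := `|w' s|.
have A0 : 0 < A by rewrite normr_gt0.
have B0 : 0 < B by rewrite normr_gt0.
(* In the frame, the sum of the two unit vectors has [e]-coordinate [2 * (1 - s) * H], and their
   difference has [e']-coordinate [2 * s * H]. *)
pose H := (A^-1 + B^-1) / 2.
have H0 : 0 < H by rewrite divr_gt0// addr_gt0// invr_gt0.
have sumge : 2 * ((1 - s) * H) <= `|normalize (w s) + normalize (w' s)|.
  apply: le_trans (gle _); rewrite linearD !linearZ/= -/A -/B /w w'E !gc.
  by rewrite /GRing.scale/= /H; lra.
have difge : k * s * H <= eps.
  have := ble (A^-1 * (1 - s) - B^-1 * (1 - s)) (A^-1 * s + B^-1 * s).
  have -> : (A^-1 * (1 - s) - B^-1 * (1 - s)) *: e + (A^-1 * s + B^-1 * s) *: e'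
     = normalize (w s) - normalize (w' s).
    rewrite /normalize -/A -/B w'E /w !scalerDr !scalerA.
    rewrite scalerBl scalerDl opprD mulrN scaleNr opprK.
    by rewrite addrACA.
  rewrite es ger0_norm; last by rewrite addr_ge0// mulr_ge0// invr_ge0 ltW.
  rewrite /H; lra.
have nH : 1 <= ((1 - s) ^+ 2 + s ^+ 2) * H ^+ 2.
  have An : A ^+ 2 <= (1 - s) ^+ 2 + s ^+ 2 by exact: emax.
  have Bn : B ^+ 2 <= (1 - s) ^+ 2 + s ^+ 2.
    by rewrite /B w'E -[in leRHS](sqrrN s); exact: emax.
  (* The mean of the inverses is at least the inverse of the larger norm, whose square is at most
     [N]. *)
  have aux (N a b : R) : 0 < a -> 0 < b -> b <= a -> a ^+ 2 <= N ->
      1 <= N * ((a^-1 + b^-1) / 2) ^+ 2.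
    move=> a0 b0 ba aN.
    have ia : a^-1 <= (a^-1 + b^-1) / 2.
      have : a^-1 <= b^-1 by rewrite lef_pV2.
      by lra.
    apply: (@le_trans _ _ (a ^+ 2 * a^-1 ^+ 2)).
      by rewrite -exprMn mulfV ?expr1n// gt_eqF.
    have ai : 0 < a^-1 by rewrite invr_gt0.
    by rewrite ler_pM ?sqr_ge0// ler_sqr ?nnegrE//; lra.
  have [BA|/ltW AB] := leP B A; first exact: aux.
  by rewrite /H (addrC A^-1); exact: aux.
have sH : (s * H) ^+ 2 <= k^-1 ^+ 2 * eps ^+ 2.
  rewrite -exprMn ler_sqr ?nnegrE.
  - by rewrite ler_pdivlMl// mulrA.
  - by rewrite mulr_ge0// ltW.
  - by rewrite mulr_ge0 ?invr_ge0 ?(ltW k0)//; case/andP: eps2.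
apply: le_trans sH.
have : 0 <= (1 - s) * H by rewrite mulr_ge0 ?subr_ge0// ltW.
move: nH; rewrite mulrDl -!exprMn.
(* Now [a ^+ 2 + b ^+ 2 >= 1], and the modulus is at most [1 - a]; if [a < 1] this is at most
   [1 - a ^+ 2 <= b ^+ 2]. *)
move: ((1 - s) * H) (s * H) sumge => a b sumge nH a0.
have [a1|a1] := leP 1 a; first by have := sqr_ge0 b; lra.
have : a ^+ 2 <= a by rewrite expr2 ler_piMl// ltW.
lra.
Qed.

(** * The modulus of smoothness: quadratic lower bound *)

Lemma smoothness_modulus_ge (R : realType) (X : normedModType R) (x y : X)
    (tau : R) : 0 <= tau -> `|x| = 1 -> `|y| = 1 ->
  (`|x + tau *: y| + `|x - tau *: y|) / 2 - 1 <= smoothness_modulus X tau.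
Proof.
move=> t0 x1 y1; apply: ub_le_sup; last by exists x, y.
exists tau => _ [u [v [u1 v1 ->]]].
have := ler_normD u (tau *: v); have := ler_normB u (tau *: v).
rewrite u1 normrZ v1 ger0_norm//; lra.
Qed.

(** The pair [e] and the normalised [e'] is tested, with the Euclidean lower bound on
    [e + c *: normalize e']. The range up to 4 covers [2 * |x - y|] for [x], [y] in the unit
    ball. *)
Lemma smoothness_modulus_quadratic (R : realType) (X : normedModType R) :
  dim_ge2 X -> exists2 c : R, 0 < c & forall tau : R, 0 <= tau <= 4 ->
    c * tau ^+ 2 <= smoothness_modulus X tau.
Proof.
move=> /min_direction[e [e' [e1 e'0 emin]]].
have k0 : 0 < `|e'| by rewrite normr_gt0.
have k1 : 1 <= `|e'| ^+ 2.
  by have := emin 0 1; rewrite scale0r scale1r add0r expr0n/= add0r expr1n.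
set k := `|e'| in k0 k1.
have ki1 : k^-1 ^+ 2 <= 1 by rewrite exprVn invf_le1// exprn_gt0.
(* The 8 comes from [(1 + w / 8) ^+ 2 <= 1 + w] for [0 <= w <= 16], used with
   [w = k^-1 ^+ 2 * tau ^+ 2]. *)
exists (k^-1 ^+ 2 / 8); first by rewrite divr_gt0// exprn_gt0// invr_gt0.
move=> tau /andP[t0 t4].
apply: le_trans (smoothness_modulus_ge t0 e1 (norm_normalize e'0)).
have key (c : R) : c ^+ 2 = tau ^+ 2 ->
    1 + k^-1 ^+ 2 / 8 * tau ^+ 2 <= `|e + c *: normalize e'|.
  move=> ct; have := emin 1 (c * k^-1); rewrite scale1r -scalerA -/k.
  have -> : k^-1 *: e' = normalize e' by [].
  rewrite expr1n exprMn ct => h.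
  have w0 : 0 <= k^-1 ^+ 2 * tau ^+ 2 by rewrite mulr_ge0 ?sqr_ge0.
  have t16 : tau ^+ 2 <= 16 by nra.
  have w16 : k^-1 ^+ 2 * tau ^+ 2 <= 16.
    by apply: le_trans t16; rewrite ler_piMl ?sqr_ge0.
  rewrite -ler_sqr ?nnegrE//; last by lra.
  apply: le_trans h; rewrite (mulrC (tau ^+ 2)).
  have -> : k^-1 ^+ 2 / 8 * tau ^+ 2 = k^-1 ^+ 2 * tau ^+ 2 / 8 by lra.
  move: (_ * _) w0 w16 => w w0 w16; nra.
have := key tau erefl; have := key (- tau) (sqrrN tau).
rewrite scaleNr; lra.
Qed.

(** The left side is even and convex in [l]: both points are convex combinations of [u + h] and
    [u - h], with weights [(1 + l) / 2] and [(1 - l) / 2] exchanged. *)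
Lemma norm_pair_mono (R : realType) (X : normedModType R) (u h : X) (l : R) :
  0 <= l <= 1 -> `|u + l *: h| + `|u - l *: h| <= `|u + h| + `|u - h|.
Proof.
move=> /andP[l0 l1].
have comb (a : R) : u + a *: h =
    ((1 + a) / 2) *: (u + h) + ((1 - a) / 2) *: (u - h).
  rewrite !scalerDr addrACA -scalerDl scalerN -scalerBl.
  have -> : (1 + a) / 2 + (1 - a) / 2 = 1 by lra.
  have -> : (1 + a) / 2 - (1 - a) / 2 = a by lra.
  by rewrite scale1r.
have := comb l; have := comb (- l); rewrite scaleNr => -> ->.
have := ler_normD (((1 + l) / 2) *: (u + h)) (((1 - l) / 2) *: (u - h)).
have := ler_normD (((1 + - l) / 2) *: (u + h)) (((1 - - l) / 2) *: (u - h)).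
rewrite !normrZ !ger0_norm; [lra|lra|lra|lra|lra].
Qed.

Local Close Scope classical_set_scope.

(** * Bounds for the divergence when the larger norm is one *)

(** The Bregman divergence of the power norm, split into a radial and an angular term; see
    [bregman_norming]. *)
Definition norming_gap {R : realType} {X : normedModType R} (p : R)
    (g : {linear X -> R^o}) (x y : X) : R :=
  young_gap p `|x| `|y| + `|x| `^ (p - 1) * (`|y| - g y).

Lemma norming_gap_lower (R : realType) (X : normedModType R) (p : R) :
  1 < p -> dim_ge2 X ->
  (forall x : X, exists g : {linear X -> R^o}, norming g x) ->
  exists2 C : R, 0 < C & forall (x y : X) (g : {linear X -> R^o}),
    norming g x -> Num.max `|x| `|y| = 1 ->
    C * convexity_modulus X (`|x - y| / 3) <= norming_gap p g x y.
Proof.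
move=> p1 hdim ex.
have [c c0 hc] := young_gap_ge p1.
have [K K0 hK] := convexity_modulus_quadratic hdim ex.
have q0 : 0 < 3^-1 `^ p :> R by rewrite powR_gt0.
have C0 : 0 < Num.min (c / K) (3^-1 `^ p) by rewrite lt_min divr_gt0.
(* The first entry serves the case where the norms differ much, the second the case where they are
   close. *)
exists (Num.min (c / K) (3^-1 `^ p)) => // x y g [gle gx] xy1.
set C := Num.min _ _ in C0 *.
have Cc : C * K <= c by rewrite -ler_pdivlMr// ge_min lexx.
have Cq : C <= 3^-1 `^ p by rewrite ge_min lexx orbT.
have yg : 0 <= `|y| - g y by rewrite subr_ge0.
have : c * (`|x| - `|y|) ^+ 2 <= young_gap p `|x| `|y| by exact: hc.
rewrite /norming_gap => hyoung.
have a1 : `|x| <= 1 by rewrite -xy1 le_max lexx.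
have b1 : `|y| <= 1 by rewrite -xy1 le_max lexx orbT.
have eps2 : `|x - y| <= 2 by apply: le_trans (ler_normB _ _) _; lra.
set eps := `|x - y| in eps2 *; have eps0 : 0 <= eps by exact: normr_ge0.
have pa := powR_ge0 `|x| (p - 1).
have [far|near] := leP (eps / 3) `| `|x| - `|y| |.
  have e2 : (eps / 3) ^+ 2 <= (`|x| - `|y|) ^+ 2.
    rewrite -[leRHS]real_normK ?num_real// ler_sqr ?nnegrE//; lra.
  have h : C * convexity_modulus X (eps / 3) <= C * K * (eps / 3) ^+ 2.
    by rewrite -mulrA ler_wpM2l ?(ltW C0)// hK//; apply/andP; split; lra.
  have h2 : C * K * (eps / 3) ^+ 2 <= c * (`|x| - `|y|) ^+ 2.
    by rewrite ler_pM ?sqr_ge0// mulr_ge0 ?ltW.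
  have := mulr_ge0 pa yg; lra.
(* The norms differ by less than 2/3 and the larger is 1, so both exceed 1/3. The angular term is
   then comparable to [1 - g] at the normalised [y]. *)
have [a3 b3] : 3^-1 <= `|x| /\ 3^-1 <= `|y|.
  move: near; rewrite ltr_norml => /andP[n1 n2].
  by move: xy1; case: (leP `|x| `|y|) => _ xy1; split; lra.
have a0 : 0 < `|x| by lra.
have b0 : 0 < `|y| by lra.
have xN : x != 0 by rewrite -normr_gt0.
have yN : y != 0 by rewrite -normr_gt0.
have xu : x = `|x| *: normalize x by rewrite scalerA divff ?gt_eqF// scale1r.
have yv : y = `|y| *: normalize y by rewrite scalerA divff ?gt_eqF// scale1r.
have u1 := norm_normalize xN; have v1 := norm_normalize yN.
have gu : norming g (normalize x).
  by split=> //; rewrite linearZ/= gx u1 /GRing.scale/= mulVf// gt_eqF.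
(* The radial part of [x - y] accounts for less than a third of [eps]; the rest is angular. *)
have uv : eps / 3 <= `|normalize x - normalize y|.
  rewrite -/eps in near.
  suff : eps <= `|normalize x - normalize y| + `| `|x| - `|y| | by lra.
  have -> : eps = `| `|x| *: (normalize x - normalize y) +
                    (`|x| - `|y|) *: normalize y|.
    by rewrite scalerBr scalerBl subrKA -xu -yv.
  apply: le_trans (ler_normD _ _) _; rewrite (normrZ `|x|) (normrZ (_ - _)).
  rewrite v1 mulr1 lerD2r normr_id.
  by rewrite ler_piMl.
have e3 : 0 <= eps / 3 <= `|normalize x - normalize y| by rewrite uv andbT; lra.
have hd := convexity_modulus_le_norming gu u1 v1 e3.
have gv0 : 0 <= 1 - g (normalize y) by rewrite subr_ge0 -v1.
have -> : `|y| - g y = `|y| * (1 - g (normalize y)).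
  by rewrite {2}yv linearZ/= /GRing.scale/= mulrBr mulr1.
have pq : 3^-1 `^ p <= `|x| `^ (p - 1) * `|y|.
  have -> : 3^-1 `^ p = 3^-1 `^ (p - 1) * 3^-1 :> R.
    by rewrite mulrC mulr_powRB1//; lra.
  rewrite ler_pM ?powR_ge0//; apply: ge0_ler_powR; rewrite ?nnegrE//; lra.
apply: (@le_trans _ _ (C * (1 - g (normalize y)))).
  by rewrite ler_wpM2l// ltW.
apply: (@le_trans _ _ (`|x| `^ (p - 1) * (`|y| * (1 - g (normalize y))))).
  by rewrite mulrA ler_wpM2r//; exact: le_trans pq.
by rewrite lerDr; apply: le_trans hyoung; rewrite mulr_ge0 ?sqr_ge0// ltW.
Qed.

(** With [h = y - x], testing [g] on [x - h] bounds the defect by the second difference of the norm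
    at [x]. Dividing by [|x|] gives an increment of length [|h| / |x| <= 2 * |h|], which
    [norm_pair_mono] enlarges to length exactly [2 * |h|]. *)
Lemma norming_defect_le (R : realType) (X : normedModType R) (x y : X)
    (g : {linear X -> R^o}) : norming g x -> 2^-1 <= `|x| <= 1 -> x != y ->
  `|y| - g y <= 2 * `|x| * smoothness_modulus X (2 * `|x - y|).
Proof.
move=> [gle gx] /andP[a2 a1] xy.
have a0 : 0 < `|x| by lra.
have xN : x != 0 by rewrite -normr_gt0.
pose h := y - x; set eps := `|x - y|.
have hN : h != 0 by rewrite subr_eq0 eq_sym.
have eh : eps = `|h| by rewrite /eps distrC.
have e0 : 0 < eps by rewrite eh normr_gt0.
have xh : x + h = y by rewrite /h addrC subrK.
have defect : `|y| - g y <= `|x + h| + `|x - h| - 2 * `|x|.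
  have := gle (x - h); rewrite linearB/= xh -gx => gxh.
  have : g h = g y - g x by rewrite /h linearB.
  lra.
pose H := (2 * eps) *: normalize h.
pose l := (2 * `|x|)^-1.
have l01 : 0 <= l <= 1.
  by rewrite /l invr_ge0 mulr_ge0//= invf_le1 ?mulr_gt0//; lra.
have lH : l *: H = `|x|^-1 *: h.
  rewrite /H scalerA /normalize -eh scalerA /l; congr (_ *: _).
  by field; rewrite !gt_eqF.
have := norm_pair_mono (normalize x) H l01.
rewrite lH -scalerDr -scalerBr !normrZ ger0_norm ?invr_ge0// -mulrDr.
rewrite ler_pdivrMl// => mono.
have e20 : 0 <= 2 * eps by rewrite mulr_ge0// ltW.
have := smoothness_modulus_ge e20 (norm_normalize xN) (norm_normalize hN).
rewrite -/H => smooth.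
have : `|x| * (`|normalize x + H| + `|normalize x - H|) <=
    `|x| * (2 * (smoothness_modulus X (2 * eps) + 1)).
  by rewrite ler_wpM2l//; lra.
lra.
Qed.

Lemma norming_gap_upper (R : realType) (X : normedModType R) (p : R) :
  1 < p -> dim_ge2 X ->
  exists2 C : R, 0 < C & forall (x y : X) (g : {linear X -> R^o}),
    norming g x -> Num.max `|x| `|y| = 1 ->
    norming_gap p g x y <= C * smoothness_modulus X (2 * `|x - y|).
Proof.
move=> p1 hdim.
have [c c0 hc] := young_gap_le p1.
have [k k0 hk] := smoothness_modulus_quadratic hdim.
(* The three summands pay for the Young gap, for the angular term when [|x| < 1/2], and for it when
   [|x| >= 1/2]. *)
exists (c / (4 * k) + 2 / k + 2).
  by rewrite !addr_gt0// divr_gt0// mulr_gt0.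
move=> x y g gn xy1; have [gle gx] := gn.
have a1 : `|x| <= 1 by rewrite -xy1 le_max lexx.
have b1 : `|y| <= 1 by rewrite -xy1 le_max lexx orbT.
have eps2 : `|x - y| <= 2 by apply: le_trans (ler_normB _ _) _; lra.
have young : young_gap p `|x| `|y| <= c * (`|x| - `|y|) ^+ 2 by exact: hc.
have dist := ler_dist_dist x y.
have := hk (2 * `|x - y|); rewrite /norming_gap.
have := normr_ge0 (x - y).
set eps := `|x - y| in eps2 dist *; set rho := smoothness_modulus X _.
move=> eps0 /(_ _)/wrap[|rhoge]; first by apply/andP; split; lra.
have rho0 : 0 <= rho by apply: le_trans rhoge; rewrite mulr_ge0 ?sqr_ge0// ltW.
have krho : k * eps ^+ 2 * 4 <= rho by move: rhoge; rewrite exprMn; lra.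
have young' : young_gap p `|x| `|y| <= c / (4 * k) * rho.
  apply: le_trans young _.
  apply: (@le_trans _ _ (c * eps ^+ 2)).
    rewrite ler_wpM2l ?(ltW c0)// -[leLHS]real_normK ?num_real//.
    by rewrite ler_sqr ?nnegrE.
  rewrite mulrAC -mulrA ler_wpM2l ?(ltW c0)// ler_pdivlMr ?mulr_gt0//; lra.
have pa0 := powR_ge0 `|x| (p - 1).
have pa1 : `|x| `^ (p - 1) <= 1.
  rewrite [leRHS](_ : 1 = 1 `^ (p - 1)); last by rewrite powR1.
  by apply: ge0_ler_powR; rewrite ?nnegrE//; lra.
have yg : 0 <= `|y| - g y by rewrite subr_ge0.
have r1 : 0 <= 2 / k * rho by rewrite mulr_ge0// divr_ge0// ltW.
suff : `|y| - g y <= 2 / k * rho + 2 * rho.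
  have : `|x| `^ (p - 1) * (`|y| - g y) <= `|y| - g y by rewrite ler_piMl.
  rewrite 2!mulrDl; lra.
have [a2|a2] := leP 2^-1 `|x|.
  have [xy|xy] := eqVneq x y; first by rewrite -xy gx subrr addr_ge0// mulr_ge0.
  have := norming_defect_le gn; rewrite a2 a1 => /(_ y isT xy).
  rewrite -/eps -/rho => h.
  have : `|x| * rho <= rho by rewrite ler_piMl.
  lra.
(* Here [|y| = 1], so [x] and [y] are far apart and [rho >= k]; the trivial bound 2 on the defect is
   enough. *)
have e12 : 2^-1 <= eps.
  move: dist; rewrite distrC => dist; have := ler_norm (`|y| - `|x|).
  by move: xy1; case: (leP `|x| `|y|) => _ xy1; lra.
have : `|y| - g y <= 2.
  by have := gle (- y); rewrite linearN normrN /=; lra.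
move/le_trans; apply; suff : 2 <= 2 / k * rho by lra.
rewrite mulrAC ler_pdivlMr// ler_wpM2l//.
have : k * 1 <= k * (eps ^+ 2 * 4) by rewrite ler_wpM2l ?(ltW k0)//; nra.
lra.
Qed.

(** * Homogeneity and comparison of powers *)

Lemma norming_scale (R : realType) (X : normedModType R)
    (g : {linear X -> R^o}) (x : X) (c : R) :
  0 <= c -> norming g x -> norming g (c *: x).
Proof.
move=> c0 [gle gx]; split=> //.
by rewrite linearZ/= gx normrZ ger0_norm.
Qed.

Lemma norming_gap_scale (R : realType) (X : normedModType R) (p c : R)
    (g : {linear X -> R^o}) (x y : X) : 1 < p -> 0 <= c ->
  norming_gap p g (c *: x) (c *: y) = c `^ p * norming_gap p g x y.
Proof.
move=> p1 c0; rewrite /norming_gap !normrZ (ger0_norm c0) young_gap_scale//.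
have -> : c `^ p = c * c `^ (p - 1) by rewrite mulr_powRB1//; lra.
by rewrite powRM// linearZ/= /GRing.scale/=; ring.
Qed.

Lemma bregman_norming (R : realType) (X : normedModType R) (p : R)
    (f : dual X) (g : {linear X -> R^o}) (x y : X) : norming g x ->
  (forall z, f z = `|x| `^ (p - 1) * g z) ->
  bregman (power_norm p) f y x = norming_gap p g x y.
Proof.
move=> [_ gx] fE.
rewrite /bregman /power_norm fE linearB/= gx /norming_gap /young_gap.
by ring.
Qed.

Lemma powR_le_of_ratio (R : realType) (e z T : R) :
  1 <= z <= T -> z `^ e <= T `^ `|e|.
Proof.
move=> /andP[z1 zT].
apply: (@le_trans _ _ (z `^ `|e|)); first by rewrite ler_powR// ler_norm.
by apply: ge0_ler_powR; rewrite ?nnegrE//; lra.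
Qed.

Lemma max_norm_ratio (R : realType) (X : normedModType R) (x y : X) (tau e : R) :
  x != 0 -> `|x - y| / `|x| <= tau ->
  let M := Num.max `|x| `|y| in
  M `^ e <= (1 + tau) `^ `|e| * `|x| `^ e /\
  ((1 + tau) `^ `|e|)^-1 * `|x| `^ e <= M `^ e.
Proof.
move=> xN h M; have a0 : 0 < `|x| by rewrite normr_gt0.
have M0 : 0 < M by rewrite lt_max a0.
have r0 : 0 <= M / `|x| by rewrite divr_ge0 ?ltW.
have rT : 1 <= M / `|x| <= 1 + tau.
  rewrite ler_pdivlMr// mul1r le_max lexx /=.
  rewrite ler_pdivrMr// ge_max mulrDl mul1r.
  move: h; rewrite ler_pdivrMr// => h.
  have := normr_ge0 (x - y); have := lerB_dist y x; rewrite distrC.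
  by move=> h1 h2; apply/andP; split; lra.
have ME : M `^ e = (M / `|x|) `^ e * `|x| `^ e.
  by rewrite -(powRM e r0 (ltW a0)) divfK// gt_eqF.
have T0 : 0 < 1 + tau by case/andP: rT => r1 r2; lra.
have p0 : 0 < (1 + tau) `^ `|e| by rewrite powR_gt0.
rewrite ME; split; rewrite ler_wpM2r ?powR_ge0//; first exact: powR_le_of_ratio.
have rp : 0 < M / `|x| by rewrite divr_gt0.
rewrite -[leRHS]invrK lef_pV2 ?posrE ?invr_gt0 ?powR_gt0// -powRN.
by rewrite -[`|e|]normrN; exact: powR_le_of_ratio.
Qed.

Lemma powR_homogeneous (R : realType) (M c eps p s : R) :
  0 < M -> 0 <= c -> 0 <= eps ->
  M `^ p * (c * eps / M) `^ s = c `^ s * (M `^ (p - s) * eps `^ s).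
Proof.
move=> M0 c0 e0.
rewrite !powRM ?mulr_ge0 ?invr_ge0 ?(ltW M0)//.
have -> : M^-1 `^ s = M `^ (- s) by rewrite powRN -powR_inv1 ?ltW// -powRrM mulN1r powRN.
rewrite powRD; first by ring.
by rewrite (gt_eqF M0) implybT.
Qed.

(** * Estimates for the Bregman divergence of the power norm *)

Section PowerNormBounds.
Context {R : realType} {X : normedModType R} (p : R).
Hypotheses (hdim : dim_ge2 X) (p1 : 1 < p).
Variable j : X -> dual X.
Hypothesis hj : duality_selection p j.

Let D (x y : X) : R := bregman (power_norm p) (j x) y x.

Lemma bregman_self (x : X) : D x x = 0.
Proof. by rewrite /D /bregman !subrr linear0 subrr. Qed.

(** Homogeneity of degree [p] reduces everything to the normalised bounds: a functional norming at
    [x] is also norming at every nonnegative multiple of [x]. *)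
Lemma bregman_normalize (x y : X) : ~ (x = 0 /\ y = 0) ->
  let M := Num.max `|x| `|y| in
  [/\ 0 < M, Num.max `|M^-1 *: x| `|M^-1 *: y| = 1,
      `|M^-1 *: x - M^-1 *: y| = `|x - y| / M &
      exists2 g, norming g (M^-1 *: x) &
        D x y = M `^ p * norming_gap p g (M^-1 *: x) (M^-1 *: y)].
Proof.
move=> xy M.
have M0 : 0 < M.
  rewrite lt_max !normr_gt0.
  by case: eqVneq => //= x0; case: eqVneq => //= y0; case: xy.
have Mi0 : 0 <= M^-1 by rewrite invr_ge0 ltW.
have [g gn jg] := norming_functional p1 hj x.
split => //.
- by rewrite !normrZ (ger0_norm Mi0) -maxr_pMr// mulVf// gt_eqF.
- by rewrite -scalerBr normrZ (ger0_norm Mi0) mulrC.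
- exists g; first exact: norming_scale.
  rewrite /D (bregman_norming _ gn jg) norming_gap_scale// mulrA.
  by rewrite -powRM ?(ltW M0)// divff ?gt_eqF// powR1 mul1r.
Qed.

Lemma bregman_upper : exists2 C : R, 0 < C &
  forall x y : X, ~ (x = 0 /\ y = 0) ->
    D x y <= C * Num.max `|x| `|y| `^ p *
      smoothness_modulus X (2 * `|x - y| / Num.max `|x| `|y|).
Proof.
have [C C0 hC] := norming_gap_upper p1 hdim.
exists C => // x y /bregman_normalize.
set M := Num.max _ _ => -[M0 M1 e [g gn ->]].
rewrite (mulrC C) -!mulrA ler_wpM2l ?powR_ge0// -e.
exact: hC.
Qed.

Lemma bregman_lower : exists2 C : R, 0 < C &
  forall x y : X, ~ (x = 0 /\ y = 0) ->
    C * Num.max `|x| `|y| `^ p *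
      convexity_modulus X (`|x - y| / (3 * Num.max `|x| `|y|)) <= D x y.
Proof.
have ex x : exists g : {linear X -> R^o}, norming g x.
  by have [g] := norming_functional p1 hj x; exists g.
have [C C0 hC] := norming_gap_lower p1 hdim ex.
exists C => // x y /bregman_normalize.
set M := Num.max _ _ => -[M0 M1 e [g gn ->]].
rewrite (mulrC C) -!mulrA ler_wpM2l ?powR_ge0//.
rewrite invfM mulrCA (mulrC 3^-1) -e.
exact: hC.
Qed.

(** Distinct points make the argument of the modulus positive, as [s_smooth] demands; on the
    diagonal the divergence vanishes. *)
Lemma bregman_upper_smooth (s : R) : s_smooth X s ->
  exists2 C : R, 0 < C & forall x y : X, x != y ->
    D x y <= C * Num.max `|x| `|y| `^ (p - s) * `|x - y| `^ s.
Proof.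
move=> [K K0 hK]; have [C C0 hC] := bregman_upper.
exists (C * K * 2 `^ s); first by rewrite !mulr_gt0// powR_gt0.
move=> x y xy.
have nxy : ~ (x = 0 /\ y = 0) by case=> x0 y0; rewrite x0 y0 eqxx in xy.
apply: le_trans (hC _ _ nxy) _.
have [M0 _ _ _] := bregman_normalize nxy.
move: (Num.max _ _) M0 => M M0.
have e0 : 0 < `|x - y| by rewrite normr_gt0 subr_eq0.
apply: (@le_trans _ _ (C * M `^ p * (K * (2 * `|x - y| / M) `^ s))).
  rewrite ler_wpM2l ?mulr_ge0 ?powR_ge0 ?(ltW C0)//.
  by apply: hK; rewrite divr_gt0// mulr_gt0.
have -> : C * M `^ p * (K * (2 * `|x - y| / M) `^ s) =
  C * K * (M `^ p * (2 * `|x - y| / M) `^ s) by ring.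
rewrite powR_homogeneous ?ler0n// le_eqVlt; apply/orP; left; apply/eqP; ring.
Qed.

Lemma bregman_lower_convex (r : R) : r_convex X r ->
  exists2 C : R, 0 < C & forall x y : X, ~ (x = 0 /\ y = 0) ->
    C * Num.max `|x| `|y| `^ (p - r) * `|x - y| `^ r <= D x y.
Proof.
move=> [K K0 hK]; have [C C0 hC] := bregman_lower.
exists (C * K * 3^-1 `^ r); first by rewrite !mulr_gt0// powR_gt0.
move=> x y nxy; apply: le_trans (hC _ _ nxy).
have [M0 _ _ _] := bregman_normalize nxy.
(* This places the argument of the modulus in [[0, 2/3]], within the range of [r_convex]. *)
have eM : `|x - y| <= 2 * Num.max `|x| `|y|.
  apply: le_trans (ler_normB _ _) _.
  have : `|x| <= Num.max `|x| `|y| by rewrite le_max lexx.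
  have : `|y| <= Num.max `|x| `|y| by rewrite le_max lexx orbT.
  lra.
move: (Num.max _ _) M0 eM => M M0 eM.
have eE : `|x - y| / (3 * M) = 3^-1 * `|x - y| / M by field; rewrite gt_eqF.
have arg : 0 <= `|x - y| / (3 * M) <= 2.
  rewrite divr_ge0 ?mulr_ge0 ?(ltW M0)//= ler_pdivrMr ?mulr_gt0//; lra.
apply: (@le_trans _ _ (C * M `^ p * (K * (`|x - y| / (3 * M)) `^ r))); last first.
  by rewrite ler_wpM2l ?mulr_ge0 ?powR_ge0 ?(ltW C0)//; exact: hK.
rewrite eE.
have -> : C * M `^ p * (K * (3^-1 * `|x - y| / M) `^ r) =
  C * K * (M `^ p * (3^-1 * `|x - y| / M) `^ r) by ring.
rewrite powR_homogeneous ?invr_ge0// le_eqVlt; apply/orP; left; apply/eqP; ring.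
Qed.

End PowerNormBounds.

Unset Implicit Arguments.

Theorem corollary4p5 (R : realType) (X : completeNormedModType R)
  (hdim : dim_ge2 X) (p : R) (hp : 1 < p)
  (j : X -> dual X) (hj : duality_selection p j) :
  (exists C1 C2 : R, [/\ 0 < C1, 0 < C2 &
     forall x y : X, ~ (x = 0 /\ y = 0) ->
       bregman (power_norm p) (j x) y x <=
         C1 * (Num.max `|x| `|y|) `^ p *
         smoothness_modulus X (2 * `|x - y| / Num.max `|x| `|y|) /\
       C2 * (Num.max `|x| `|y|) `^ p *
         convexity_modulus X (`|x - y| / (3 * Num.max `|x| `|y|)) <=
         bregman (power_norm p) (j x) y x]) /\
  (forall s : R, s_smooth X s ->
     (p = s ->
        exists2 C : R, 0 < C & forall x y : X,
          bregman (power_norm p) (j x) y x <= C * `|x - y| `^ s) /\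
     (p <> s ->
        forall tau : R, 0 < tau ->
        exists2 C : R, 0 < C & forall x y : X,
          x <> 0 -> `|x - y| / `|x| <= tau ->
          bregman (power_norm p) (j x) y x <=
            C * `|x| `^ (p - s) * `|x - y| `^ s)) /\
  (forall r : R, r_convex X r ->
     (p = r ->
        exists2 C : R, 0 < C & forall x y : X,
          C * `|x - y| `^ r <= bregman (power_norm p) (j x) y x) /\
     (p <> r ->
        forall tau : R, 0 < tau ->
        exists2 C : R, 0 < C & forall x y : X,
          x <> 0 -> `|x - y| / `|x| <= tau ->
          C * `|x| `^ (p - r) * `|x - y| `^ r <=
            bregman (power_norm p) (j x) y x)).
Proof.
split; last split.
- have [C1 C10 h1] := bregman_upper hdim hp hj.
  have [C2 C20 h2] := bregman_lower hdim hp hj.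
  by exists C1, C2; split=> // x y xy; split; [exact: h1 | exact: h2].
- move=> s hs; have [C C0 hC] := bregman_upper_smooth hdim hp hj hs; split.
    move=> ps; exists C => // x y.
    have [<-|xy] := eqVneq x y.
      by rewrite bregman_self mulr_ge0 ?powR_ge0 ?ltW.
    (* For equal exponents the factor in the maximum of the norms has exponent 0 and disappears. *)
    by have := hC x y xy; rewrite ps subrr powRr0 mulr1.
  move=> _ tau tau0; exists (C * (1 + tau) `^ `|p - s|).
    by rewrite mulr_gt0// powR_gt0//; lra.
  move=> x y /eqP xN xt; have [<-|xy] := eqVneq x y.
    by rewrite bregman_self !mulr_ge0 ?powR_ge0 ?ltW.
  apply: le_trans (hC x y xy) _.
  rewrite ler_wpM2r ?powR_ge0// -mulrA ler_wpM2l ?(ltW C0)//.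
  by have [] := max_norm_ratio (p - s) xN xt.
- move=> r hr; have [C C0 hC] := bregman_lower_convex hdim hp hj hr; split.
    move=> pr; exists C => // x y.
    have [[-> ->]|xy] := pselect (x = 0 /\ y = 0).
      by rewrite bregman_self subrr normr0 powR0 ?mulr0// -pr gt_eqF//; lra.
    by have := hC x y xy; rewrite pr subrr powRr0 mulr1.
  move=> _ tau tau0; have T0 : 0 < (1 + tau) `^ `|p - r|.
    by rewrite powR_gt0//; lra.
  exists (C * ((1 + tau) `^ `|p - r|)^-1).
    by rewrite mulr_gt0// invr_gt0.
  move=> x y xN xt.
  have nxy : ~ (x = 0 /\ y = 0) by case.
  apply: le_trans (hC x y nxy).
  rewrite ler_wpM2r ?powR_ge0// -mulrA ler_wpM2l ?(ltW C0)//.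
  by move/eqP: xN => xN; have [] := max_norm_ratio (p - r) xN xt.
Qed.
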